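(* Let $k$ and $w$ be positive integers. Suppose that $\mathcal{A}$ is a $k$-crossing-free antichain in $\mathbb{Z}^w$, and suppose that there is a coordinate $j\in\{1,\ldots,w\}$ on which all vectors of $\mathcal{A}$ are different, i.e. $A[j]\neq B[j]$ for all distinct $A,B\in\mathcal{A}$. Then $|\mathcal{A}|\leq k^{w-1}$.
   Context: $A[i]$ denotes the $i$th coordinate of $A\in\mathbb{Z}^w$, $1\leq i\leq w$. For $A,B\in\mathbb{Z}^w$, $A\leq B$ means $A[i]\leq B[i]$ for every coordinate $i$ (product order); antichains in $\mathbb{Z}^w$ are with respect to this order. Vectors $A,B\in\mathbb{Z}^w$ are $k$-crossing if there are coordinates $i$ and $j$ with $A[i]-B[i]\geq k$ and $B[j]-A[j]\geq k$. A family of vectors is $k$-crossing-free if it contains no two $k$-crossing vectors. *)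

(* Defs.v *)
From mathcomp Require Export all_boot all_order all_algebra.
From mathcomp Require Export boolp classical_sets functions cardinality.

Set Implicit Arguments.
Unset Strict Implicit.
Unset Printing Implicit Defensive.

Import Order.TTheory GRing.Theory Num.Theory.
Local Open Scope ring_scope.

(* Vectors of Z^w are functions 'I_w -> int. The relation [<=] between them is
   the pointwise order that boolp.v puts on function types (see [lefP]). *)

Definition antichain (d : Order.disp_t) (T : porderType d) (F : set T) : Prop :=
  forall A B : T, F A -> F B -> (A <= B)%O -> A = B.

Definition crossing (k w : nat) (A B : 'I_w -> int) : Prop :=
  exists i j : 'I_w, (k%:Z <= A i - B i) /\ (k%:Z <= B j - A j).

Definition crossing_free (k w : nat) (F : set ('I_w -> int)) : Prop :=
  ~ exists A B : 'I_w -> int, [/\ F A, F B, A <> B & crossing k A B].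

(* Main.v *)
(* Sort the vectors by their j-th coordinate.  For every other coordinate i, a
   chain of k + 1 vectors along which the j-th coordinate increases and the i-th
   one decreases would have k-crossing end points, so all such chains have
   at most k elements.  Label each vector by the heights of the longest such
   chains ending at it, one height in {0, ..., k - 1} for each i <> j.  As in
   the Erdos-Szekeres theorem the labelling is injective: in an antichain,
   any two vectors are consecutive in a chain of one of these kinds. *)
Require Import Defs.
From mathcomp Require Import zify.

Import Order.TTheory GRing.Theory Num.Theory.

Local Open Scope classical_set_scope.
Local Open Scope card_scope.

(** [n] counts the steps, so the chain has [n.+1] members, with [x] the last. *)
Fixpoint ends_chain {T : Type} (R : T -> T -> Prop) (n : nat) (x : T) : Prop :=
  if n is m.+1 then exists2 y, R y x & ends_chain R m y else True.

(** Take as height of [x] the largest [n] with [ends_chain R n x]; if [R x y], a longest chain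
    ending at [x] extends to [y]. *)
Lemma height_exists (T : Type) (R : T -> T -> Prop) (k : nat) :
  (forall x, ~ ends_chain R k.+1 x) ->
  exists h : T -> 'I_k.+1, forall x y, R x y -> (h x < h y)%N.
Proof.
move=> no_chain.
have chain_le m n x : (m <= n)%N -> ends_chain R n x -> ends_chain R m x.
  elim: n m x => [|n IHn] [|m] x //= le_mn [y Ryx ch_y].
  by exists y => //; apply: IHn ch_y.
have chain_bound x n : `[< ends_chain R n x >] -> (n <= k)%N.
  move=> /asboolP ch_x; rewrite leqNgt; apply/negP => lt_kn.
  exact: no_chain (chain_le _ _ _ lt_kn ch_x).
have chain0 x : exists n, `[< ends_chain R n x >].
  by exists 0%N; apply/asboolP.
pose ht x := ex_maxn (chain0 x) (chain_bound x).
have ht_le x : (ht x <= k)%N by rewrite /ht; case: ex_maxnP => n /chain_bound.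
exists (fun x => inord (ht x)) => x y Rxy.
rewrite !inordK ?ltnS ?ht_le // /ht.
case: ex_maxnP => m /asboolP ch_x _; case: ex_maxnP => n _; apply.
by apply/asboolP; exists x.
Qed.

Lemma card_le_finType (T : Type) (U : finType) (A : set T) (f : T -> U) :
  {in A &, injective f} -> A #<= `I_#|U|.
Proof.
move=> f_inj.
have g_inj : {in A &, injective (fun x => nat_of_ord (enum_rank (f x)))}.
  by move=> x y Ax Ay /val_inj/enum_rank_inj; apply: f_inj.
rewrite -(card_le_eql (inj_card_eq g_inj)); apply: subset_card_le.
by move=> _ [x _ <-] /=.
Qed.

(** Over the integers, each step changes [f] and [g] by at least 1. *)
Lemma ends_chain_opposite {T : Type} (F : set T) (f g : T -> int) (n : nat) (x : T) :
  F x ->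
  ends_chain (fun y z => [/\ F y, F z, (f y < f z)%R & (g z < g y)%R]) n x ->
  exists y, [/\ F y, (n%:Z <= f x - f y)%R & (n%:Z <= g y - g x)%R].
Proof.
elim: n x => [|n IHn] x Fx /=; first by exists x; rewrite !subrr.
case=> y [Fy _ lt_f lt_g] /(IHn y Fy)[z [Fz le_f le_g]].
by exists z; split=> //; lia.
Qed.

Theorem proposition17 (k w : nat) (k_gt0 : (0 < k)%N) (w_gt0 : (0 < w)%N)
    (F : set ('I_w -> int))
    (F_crossing_free : crossing_free k F)
    (F_antichain : antichain F)
    (F_distinct : exists j : 'I_w,
       forall A B : 'I_w -> int, F A -> F B -> A <> B -> A j <> B j) :
  F #<= `I_(k ^ (w - 1)).
Proof.
case: k k_gt0 F_crossing_free => // k _ F_free.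
case: w w_gt0 F F_free F_antichain F_distinct => // w _ F F_free F_anti [j F_j].
(* Membership in [F] is built into [R], so a vector outside [F] ends no chain of positive length and
   heights exist on the whole type. *)
pose R i A B := [/\ F A, F B, (A j < B j)%R & (B i < A i)%R].
have height i : exists h : ('I_w.+1 -> int) -> 'I_k.+1,
    forall A B, R i A B -> (h A < h B)%N.
  apply: height_exists => A ch_A.
  have FA : F A by case: (ch_A) => B [].
  have [B [FB le_j le_i]] :=
    ends_chain_opposite _ (fun A => A j) (fun A => A i) _ _ FA ch_A.
  apply: F_free; exists A, B; split=> //; last by exists j, i.
  by move=> eqAB; rewrite eqAB subrr in le_j.
have [h hP] := choice height.
pose label A := [ffun i : 'I_w => h (lift j i) A].
have label_neq A B : F A -> F B -> (A j < B j)%R -> label A <> label B.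
  move=> FA FB lt_j eq_label.
  suff /(F_anti _ _ FA FB) eqAB : (A <= B)%O by rewrite eqAB ltxx in lt_j.
  apply/lefP => i; case: (unliftP j i) => [i' ->|->]; last exact: ltW.
  (* A descent from [A] to [B] at this coordinate would be a step of [R], making the labels differ
     there. *)
  rewrite leNgt; apply/negP => lt_i.
  have /hP : R (lift j i') A B by [].
  have := congr1 (fun l : {ffun _ -> _} => l i') eq_label.
  by rewrite !ffunE => ->; rewrite ltnn.
have -> : (k.+1 ^ (w.+1 - 1) = #|{: {ffun 'I_w -> 'I_k.+1}}|)%N.
  by rewrite card_ffun !card_ord subn1.
apply: (@card_le_finType _ _ _ label) => A B /set_mem FA /set_mem FB eq_label.
apply: contrapT => /(F_j _ _ FA FB)/eqP.
by case: ltgtP => // lt_j _; [apply: (label_neq A B) | apply: (label_neq B A)].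
Qed.
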